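(* Let $q\in\mathbb{C}$ with $|q|<1$, $r\in\mathbb{N}$, $n\in\mathbb{Z}_{\ge0}$, $x\in\mathbb{R}$ with $x\notin\{0,-1,-2,\ldots\}$, and let $\chi$ be a Dirichlet character with conductor $f\in\mathbb{N}$, $f$ odd. Define $E^{(r)}_{n,\chi,q}(x)$ by $$[2]_q^r\sum_{m_1,\ldots,m_r=0}^{\infty}(-q)^{m_1+\cdots+m_r}\Big(\prod_{i=1}^r\chi(m_i)\Big)e^{[m_1+\cdots+m_r+x]_q t}=\sum_{n=0}^{\infty}E^{(r)}_{n,\chi,q}(x)\frac{t^n}{n!},$$ and $$l_q(s,x\mid\chi)=[2]_q^r\sum_{m_1,\ldots,m_r=0}^{\infty}\frac{(-q)^{m_1+\cdots+m_r}\prod_{i=1}^r\chi(m_i)}{[m_1+\cdots+m_r+x]_q^s},\qquad s\in\mathbb{C}.$$ Then $l_q(-n,x\mid\chi)=E^{(r)}_{n,\chi,q}(x)$.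
   Context: For $y\in\mathbb{C}$, $[y]_q=\frac{1-q^y}{1-q}$, where $q^y=e^{y\log q}$ for a fixed choice of $\log q$; $[2]_q=1+q$. *)

(* Defs.v *)
From HB Require Import structures.
From mathcomp Require Import all_boot all_order all_algebra.
From mathcomp Require Import finmap complex.
From mathcomp Require Import all_classical all_reals all_analysis.
From mathcomp.analysis.showcase Require Import summability.

Set Implicit Arguments.
Unset Strict Implicit.
Unset Printing Implicit Defensive.

Import Order.TTheory GRing.Theory Num.Theory.
Import numFieldNormedType.Exports.

Local Open Scope classical_set_scope.
Local Open Scope ring_scope.

(* Multiple series over (m_1, ..., m_r) in nat^r, understood as unconditional
   sums: limits of the finite partial sums along the filter [totally] of
   finite index sets.  They are stated over an abstract numFieldType because
   R[i] only gets its topology through that structure. *)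
Section MultipleSeries.
Context {K : numFieldType} {r : nat}.
Implicit Types u : {ffun 'I_r -> nat} -> K.

Definition msummable u : Prop := cvg (partial_sum u @ totally).

Definition msum u : K := lim (partial_sum u @ totally).

End MultipleSeries.

Definition has_series_sum {K : numFieldType} (u : nat -> K) (l : K) : Prop :=
  series u @ \oo --> l.

Section ComplexFunctions.
Context {R : realType}.
Implicit Types z s : R[i].

Definition cexp z : R[i] :=
  (expR (complex.Re z) * cos (complex.Im z)
     +i* (expR (complex.Re z) * sin (complex.Im z)))%C.

Definition cmod z : R := complex.Re `|z|.

(* Principal argument, in ]-pi, pi] for z != 0. *)
Definition carg z : R :=
  let a := acos (complex.Re z / cmod z) in
  if 0 <= complex.Im z then a else - a.

Definition clog z : R[i] := (ln (cmod z) +i* carg z)%C.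

(* Principal branch of z ^ s; only meaningful for z != 0. *)
Definition cpow z s : R[i] := cexp (s * clog z).

End ComplexFunctions.

Section DirichletCharacter.
Context {R : realType}.
Implicit Types chi : int -> R[i].

Definition dirichlet_character (N : nat) chi : Prop :=
  [/\ (0 < N)%N,
      forall a b : int, chi (a * b) = chi a * chi b,
      forall a b : int, (a = b %[mod N%:Z])%Z -> chi a = chi b
    & forall a : int, (chi a != 0) = coprimez a N%:Z].

Definition induced_modulus (N : nat) chi (d : nat) : Prop :=
  (d %| N)%N /\
  forall a : int, coprimez a N%:Z -> (a = 1 %[mod d%:Z])%Z -> chi a = 1.

(* chi is a Dirichlet character, to some modulus N (not necessarily f), and f
   is its conductor, i.e. its smallest induced modulus. *)
Definition dirichlet_character_of_conductor (f : nat) chi : Prop :=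
  exists N : nat,
    [/\ dirichlet_character N chi, induced_modulus N chi f
      & forall d : nat, induced_modulus N chi d -> (f <= d)%N].

End DirichletCharacter.

(* L is the chosen value of log q; it determines q = cexp L. *)
Section QEuler.
Context {R : realType}.
Variables (q L : R[i]) (r : nat) (chi : int -> R[i]) (x : R).

Definition qpow (y : R[i]) : R[i] := cexp (y * L).

Definition qnum (y : R[i]) : R[i] := (1 - qpow y) / (1 - q).

Definition mtot (m : {ffun 'I_r -> nat}) : nat := (\sum_i m i)%N.

Definition qweight (m : {ffun 'I_r -> nat}) : R[i] :=
  (- q) ^+ mtot m * \prod_(i < r) chi (m i)%:Z.

Definition qshift (m : {ffun 'I_r -> nat}) : R[i] :=
  qnum ((mtot m)%:R + x%:C)%C.

Definition qgen_term (t : R[i]) (m : {ffun 'I_r -> nat}) : R[i] :=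
  qweight m * cexp (qshift m * t).

Definition qgen (t : R[i]) : R[i] := qnum 2 ^+ r * msum (qgen_term t).

Definition is_qEuler (E : nat -> R[i]) : Prop :=
  forall t : R[i],
    msummable (qgen_term t) /\
    has_series_sum (fun n => E n * (t ^+ n / n`!%:R)) (qgen t).

(* The sequence is determined by is_qEuler (uniqueness of power series
   coefficients); xget returns the default 0 if no such sequence exists. *)
Definition qEuler : nat -> R[i] := xget (fun=> 0) [set E | is_qEuler E].

Definition ql_term (s : R[i]) (m : {ffun 'I_r -> nat}) : R[i] :=
  qweight m / cpow (qshift m) s.

Definition ql (s : R[i]) : R[i] := qnum 2 ^+ r * msum (ql_term s).

End QEuler.

(* Main.v *)
(* Write w_m for the weight of the multi-index m and s_m = [|m| + x]_q.  Since
   chi is bounded and |q| < 1, the weights are absolutely summable; the s_m are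
   bounded, so expanding exp(s_m t) and exchanging the sums shows that
   E_n = [2]_q^r sum_m w_m s_m^n satisfies the defining identity of the q-Euler
   numbers, and uniqueness of power series coefficients makes it the only such
   sequence.  As x is not a nonpositive integer and Re (log q) < 0, no s_m
   vanishes, so the principal power s_m^(-(-n)) is the ordinary n-th power and
   l_q(-n, x | chi) is the same sum. *)
Require Import Defs.
From mathcomp Require Import all_boot all_order all_algebra.
From mathcomp Require Import finmap complex.
From mathcomp Require Import all_classical all_reals all_analysis.
From mathcomp Require Import ring lra.
From mathcomp.analysis.showcase Require Import summability.

Set Implicit Arguments.
Unset Strict Implicit.
Unset Printing Implicit Defensive.

Import Order.TTheory GRing.Theory Num.Theory.
Import numFieldNormedType.Exports.
Local Open Scope classical_set_scope.
Local Open Scope ring_scope.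

(* Unconditional sums along finite index sets *)
#[local] Existing Instance totally_filter.

(** Relational form of the multiple sum, over any index type: with the limit named, linearity
    follows from the limit rules, and [has_usum_msum] returns to [msummable] and [msum]. *)
Definition has_usum {K : numFieldType} {I : choiceType} (u : I -> K) (l : K) :=
  partial_sum u @ totally --> l.

Section Summation.
Context {K : numFieldType} {I : choiceType}.
Implicit Types (u v : I -> K) (A B : {fset I}).

Lemma partial_sumE u A : partial_sum u A = \sum_(i <- A) u i.
Proof. by rewrite [RHS]big_seq_fsetE. Qed.

Lemma partial_sumD u v A :
  partial_sum (fun i => u i + v i) A = partial_sum u A + partial_sum v A.
Proof. by rewrite /partial_sum big_split. Qed.

Lemma partial_sumMl c u A :
  partial_sum (fun i => c * u i) A = c * partial_sum u A.
Proof. by rewrite /partial_sum mulr_sumr. Qed.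

Lemma ler_partial_sum u v A : (forall i, u i <= v i) ->
  partial_sum u A <= partial_sum v A.
Proof. by move=> uv; apply: ler_sum => i _. Qed.

Lemma partial_sum_subset u A B : (forall i, 0 <= u i) -> (A `<=` B)%fset ->
  partial_sum u A <= partial_sum u B.
Proof.
move=> u0 AB; rewrite !partial_sumE (big_fsetID _ (mem A) B) /=.
have -> : [fset x | x in B & x \in A]%fset = A.
  apply/fsetP => i; rewrite !inE /= andbC.
  by case: (boolP (i \in A)) => //= /(fsubsetP AB).
by rewrite lerDl; apply: sumr_ge0.
Qed.

Lemma has_usumD u v (a b : K) :
  has_usum u a -> has_usum v b ->
  has_usum (fun i => u i + v i) (a + b).
Proof.
move=> ua vb; rewrite /has_usum; have -> : partial_sum (fun i => u i + v i)
    = (partial_sum u : {fset I} -> K) + partial_sum v.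
  by apply/funext => A; rewrite partial_sumD.
exact: cvgD.
Qed.

Lemma has_usumMl c u (a : K) : has_usum u a ->
  has_usum (fun i => c * u i) (c * a).
Proof.
move=> ua; rewrite /has_usum; have -> : partial_sum (fun i => c * u i)
    = (fun A => c * partial_sum u A).
  by apply/funext => A; rewrite partial_sumMl.
exact: cvgMl_tmp.
Qed.

Lemma has_usum_sum n (u : nat -> I -> K) (a : nat -> K) :
  (forall k, has_usum (u k) (a k)) ->
  has_usum (fun i => \sum_(k < n) u k i) (\sum_(k < n) a k).
Proof.
move=> ua; elim: n => [|n IHn].
  rewrite /has_usum big_ord0; under eq_fun do rewrite big_ord0.
  have -> : partial_sum (fun _ : I => 0 : K) = cst 0.
    by apply/funext => A; rewrite /partial_sum big1.
  exact: cvg_cst.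
have -> : (fun i => \sum_(k < n.+1) u k i)
    = (fun i => \sum_(k < n) u k i + u n i).
  by apply/funext => i; rewrite big_ord_recr.
by rewrite big_ord_recr; exact: has_usumD.
Qed.

(** Some finite partial sum lies within [e] of [l], and its modulus is at most [M] by the triangle
    inequality. *)
Lemma has_usum_norm_le u (l M : K) : has_usum u l ->
  (forall A, partial_sum (fun i => `|u i|) A <= M) -> `|l| <= M.
Proof.
move=> ul uM; apply/ler_addgt0Pr => e e0.
have [A lA] : exists A, `|l - partial_sum u A| < e.
  by move/cvgrPdist_lt/(_ e e0)/filter_ex : ul.
rewrite -(subrK (partial_sum u A) l) addrC (le_trans (ler_normD _ _))//.
apply: lerD; last exact: ltW.
by apply: (le_trans _ (uM A)); exact: ler_norm_sum.
Qed.

End Summation.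

(** * Complex modulus against real and imaginary parts *)

Section ComplexModulus.
Context {R : realType}.
Implicit Types z : R[i].

Lemma norm_cmod z : `|z| = (cmod z)%:C%C.
Proof. by rewrite /cmod normc_def. Qed.

Lemma Re_le_cmod z : `|complex.Re z| <= cmod z.
Proof. by rewrite -lecR -norm_cmod normc_ge_Re. Qed.

Lemma Im_le_cmod z : `|complex.Im z| <= cmod z.
Proof.
rewrite /cmod normc_def /= -sqrtr_sqr ler_sqrt ?lerDr ?sqr_ge0//.
by rewrite addr_ge0 ?sqr_ge0.
Qed.

End ComplexModulus.

(** * Absolute summability of complex families *)

Section ComplexSummation.
Context {R : realType} {I : choiceType}.
Implicit Types (u : I -> R[i]) (a : I -> R).

Lemma real_complex_partial_sum a (A : {fset I}) :
  partial_sum (fun i => (a i)%:C%C) A = (partial_sum a A)%:C%C.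
Proof. by rewrite /partial_sum -rmorph_sum. Qed.

(** The sum is the supremum of the finite partial sums: once a finite set comes within [e] of it, so
    does every larger one, since the terms are nonnegative. *)
Lemma has_usum_nneg a (M : R) : (forall i, 0 <= a i) ->
  (forall A, partial_sum a A <= M) ->
  exists l : R[i],
    has_usum (fun i => (a i)%:C%C) l.
Proof.
move=> a0 aM; pose S := [set partial_sum a A | A in setT].
have supS : has_sup S.
  split; first by exists (partial_sum a fset0); exists fset0.
  by exists M => _ [A _ <-].
exists (sup S)%:C%C; apply/cvgrPdist_lt => e e0.
have eE : e = (complex.Re e)%:C%C by rewrite RRe_real// gtr0_real.
have e0' : 0 < complex.Re e by move: e0; rewrite {1}eE ltcR.
have [_ [A _ <-] SA] := sup_adherent e0' supS.
exists A => // B /= AB.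
rewrite real_complex_partial_sum -rmorphB /= norm_cmod eE ltcR /cmod.
rewrite normc_def /= expr0n addr0 sqrtr_sqr ger0_norm; last first.
  by rewrite subr_ge0 ub_le_sup//; [exact: supS.2|exists B].
rewrite ltrBlDr addrC -ltrBlDr; apply: (lt_le_trans SA).
exact: partial_sum_subset.
Qed.

(** Real and imaginary parts are summed separately, each being dominated by the modulus. *)
Lemma has_usum_abs u (M : R[i]) :
  (forall A, partial_sum (fun i => `|u i|) A <= M) ->
  exists l : R[i], has_usum u l.
Proof.
move=> uM.
pose N i := cmod (u i).
have N0 i : 0 <= N i by rewrite -ler0c /N -norm_cmod.
have NM A : partial_sum N A <= complex.Re M.
  have := uM A; under eq_fun do rewrite norm_cmod.
  by rewrite real_complex_partial_sum lecE => /andP[_].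
(* A real family dominated by [N] is the difference of the nonnegative families [N + a] and [N],
   both with bounded partial sums. *)
have PM (a : I -> R) : (forall i, `|a i| <= N i) ->
    exists l : R[i], has_usum (fun i => (a i)%:C%C) l.
  move=> aN.
  have [l1 h1] : exists l : R[i],
      has_usum (fun i => (N i)%:C%C) l.
    exact: has_usum_nneg NM.
  have [l2 h2] : exists l : R[i],
      has_usum (fun i => (N i + a i)%:C%C) l.
    apply: (@has_usum_nneg _ (complex.Re M + complex.Re M)).
      by move=> i; have := aN i; rewrite ler_norml => /andP[]; lra.
    move=> A; apply: (@le_trans _ _ (partial_sum N A + partial_sum N A)).
      rewrite -partial_sumD; apply: ler_partial_sum => i.
      by have := aN i; rewrite ler_norml => /andP[]; lra.
    by rewrite lerD.
  exists (l2 + (-1) * l1); have -> : (fun i => (a i)%:C%C)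
      = (fun i => (N i + a i)%:C%C + (-1) * (N i)%:C%C).
    by apply/funext => i; rewrite mulN1r -rmorphB /= addrC addKr.
  exact: (has_usumD h2 (has_usumMl (c := -1) h1)).
have [l1 h1] := PM (fun i => complex.Re (u i)) (fun i => Re_le_cmod _).
have [l2 h2] := PM (fun i => complex.Im (u i)) (fun i => Im_le_cmod _).
exists (l1 + 'i%C * l2).
have -> : u =
    (fun i => (complex.Re (u i))%:C%C + 'i%C * (complex.Im (u i))%:C%C).
  by apply/funext => i; rewrite -complexE.
exact: (has_usumD h1 (has_usumMl (c := 'i%C) h2)).
Qed.

End ComplexSummation.

(** * Derivatives of Taylor polynomials and integration of monomial bounds *)

Lemma is_derive_monomial (R : realType) (M : R) (n : nat) (t : R) :
  is_derive t 1 (fun s : R => M * (s ^+ n.+1 / n.+1`!%:R))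
    (M * (t ^+ n / n`!%:R)).
Proof.
have -> : (fun s : R => M * (s ^+ n.+1 / n.+1`!%:R))
    = (M / n.+1`!%:R) \*: ((@id R) ^+ n.+1).
  by apply/funext => y; rewrite /= mulrCA mulrC /GRing.scale /= exprfctE.
apply: is_derive_eq.
rewrite /= /GRing.scale /= mulr1 factS natrM.
have : n.+1%:R != 0 :> R by rewrite pnatr_eq0.
have : n`!%:R != 0 :> R by rewrite pnatr_eq0 -lt0n fact_gt0.
by move=> ? ?; field; apply/andP.
Qed.

Lemma is_derive_exp_poly (R : realType) (c : nat -> R) (n : nat) (t : R) :
  is_derive t 1 (fun s : R => \sum_(k < n.+1) c k * (s ^+ k / k`!%:R))
    (\sum_(k < n) c k.+1 * (t ^+ k / k`!%:R)).
Proof.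
elim: n => [|n IHn].
  rewrite big_ord0.
  have -> : (fun s : R => \sum_(k < 1) c k * (s ^+ k / k`!%:R))
      = cst (c 0%N).
    by apply/funext => s; rewrite big_ord1 expr0 divr1 mulr1.
  exact: is_derive_cst.
rewrite big_ord_recr /=.
have -> : (fun s : R => \sum_(k < n.+2) c k * (s ^+ k / k`!%:R))
    = (fun s : R => \sum_(k < n.+1) c k * (s ^+ k / k`!%:R))
      + (fun s : R => c n.+1 * (s ^+ n.+1 / n.+1`!%:R)).
  by apply/funext => s; rewrite big_ord_recr.
by apply: is_deriveD; exact: is_derive_monomial.
Qed.

(** The bound on [F] is the antiderivative [m] of the bound on [dF]. For either sign [e], [m - e F]
    vanishes at 0 and has nonnegative derivative on the open unit interval; the two signs together
    bound [|F|]. *)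
Lemma normr_le_monomial (R : realType) (F dF : R -> R) (M : R) (n : nat) :
  F 0 = 0 -> (forall s : R, is_derive s 1 F (dF s)) ->
  (forall s, 0 <= s <= 1 -> `|dF s| <= M * (s ^+ n / n`!%:R)) ->
  forall s, 0 <= s <= 1 -> `|F s| <= M * (s ^+ n.+1 / n.+1`!%:R).
Proof.
move=> F0 dFE dFM s /andP[s0 s1].
pose m := fun s : R => M * (s ^+ n.+1 / n.+1`!%:R).
have dm (t : R) : is_derive t 1 m (M * (t ^+ n / n`!%:R)).
  exact: is_derive_monomial.
have m0 : m 0 = 0 by rewrite /m expr0n mul0r mulr0.
have key (e : R) : `|e| = 1 -> 0 <= m s - e * F s.
  move=> e1; pose g := m - e \*: F.
  have dg (t : R) : is_derive t 1 g (M * (t ^+ n / n`!%:R) - e *: dF t).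
    exact: is_deriveB.
  have -> : m s - e * F s = g s by [].
  have -> : 0 = g 0 by rewrite /g /= !fctE /= F0 m0 scaler0 subr0.
  apply: (@ger0_derive1_ndecr _ g 0 1) => //.
  - move=> t; rewrite in_itv /= => /andP[t0 t1].
    rewrite derive1E (derive_val (is_derive := dg t)) subr_ge0.
    have t01 : 0 <= t <= 1 by rewrite !ltW.
    apply: le_trans (dFM t t01); apply: le_trans (ler_norm _) _.
    by rewrite normrM e1 mul1r.
  - by apply: derivable_within_continuous => t _; case: (dg t).
rewrite ler_norml; apply/andP; split.
- have := key (-1); rewrite normrN1 => /(_ erefl); rewrite /m; lra.
- have := key 1; rewrite normr1 => /(_ erefl); rewrite /m; lra.
Qed.

(** * Complex exponential, principal logarithm and powers *)

Section ComplexExponential.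
Context {R : realType}.
Implicit Types z w : R[i].

Lemma cexpD z w : cexp (z + w) = cexp z * cexp w.
Proof.
case: z w => [a b] [c d]; rewrite /cexp /= expRD cosD sinD.
by apply/eqP; rewrite eq_complex /=; apply/andP; split; apply/eqP; ring.
Qed.

Lemma cexp0 : cexp (0 : R[i]) = 1.
Proof. by rewrite /cexp /= expR0 cos0 sin0 mulr1 mulr0. Qed.

Lemma cexpMn z n : cexp (n%:R * z) = cexp z ^+ n.
Proof.
elim: n => [|n IHn]; first by rewrite mul0r cexp0.
by rewrite -natr1 mulrDl mul1r cexpD IHn exprSr.
Qed.

Lemma norm_cexp z : `|cexp z| = (expR (complex.Re z))%:C%C.
Proof.
rewrite normc_def /=; congr (_%:C%C).
rewrite !exprMn -mulrDr cos2Dsin2 mulr1 sqrtr_sqr ger0_norm//.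
Qed.

Lemma cexp_neq0 z : cexp z != 0.
Proof. by rewrite -normr_eq0 norm_cexp eq_complex /= gt_eqF ?expR_gt0. Qed.

Lemma cexpN z : cexp (- z) = (cexp z)^-1.
Proof.
by apply: (mulfI (cexp_neq0 z)); rewrite -cexpD subrr cexp0 divff// cexp_neq0.
Qed.

(** With [c = Re z / |z|], [sin (acos c)] is the square root of [1 - c^2], that is [|Im z| / |z|];
    the sign chosen in [carg] restores the sign of [Im z]. *)
Lemma cexp_clog z : z != 0 -> cexp (clog z) = z.
Proof.
move=> z0; have m0 : 0 < cmod z.
  by rewrite -ltcR /cmod RRe_real ?normr_real// normr_gt0.
have mE : cmod z ^+ 2 = complex.Re z ^+ 2 + complex.Im z ^+ 2.
  by rewrite /cmod normc_def /= sqr_sqrtr// addr_ge0 ?sqr_ge0.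
pose c := complex.Re z / cmod z.
have c2 : 1 - c ^+ 2 = (complex.Im z / cmod z) ^+ 2.
  rewrite /c !exprMn !exprVn mE.
  have : complex.Re z ^+ 2 + complex.Im z ^+ 2 != 0.
    by rewrite -mE expf_neq0// gt_eqF.
  by move=> ?; field.
have c1 : -1 <= c <= 1.
  have : c ^+ 2 <= 1 by rewrite -subr_ge0 c2 sqr_ge0.
  by move=> ?; apply/andP; split; nra.
have sE : sin (acos c) = `|complex.Im z| / cmod z.
  by rewrite sin_acos// c2 sqrtr_sqr normf_div (gtr0_norm m0).
rewrite /cexp /clog /= lnK ?posrE// /carg -/c.
have [I0|I0] := leP 0 (complex.Im z).
  rewrite acosK// sE ger0_norm// !(mulrC (cmod z)) !divfK ?gt_eqF//.
  by case: (z).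
rewrite cosN sinN acosK// sE ltr0_norm// mulNr opprK.
by rewrite !(mulrC (cmod z)) !divfK ?gt_eqF//; case: (z).
Qed.

(** At integer exponents the choice of branch disappears, since [exp (n log z)] is the [n]-th power
    of [exp (log z) = z]. *)
Lemma cpow_opp_nat z n : z != 0 -> cpow z (- n%:R) = (z ^+ n)^-1.
Proof. by move=> z0; rewrite /cpow mulNr cexpN cexpMn cexp_clog. Qed.

End ComplexExponential.

(** * Taylor remainder of the complex exponential *)

Section ComplexExponentialSeries.
Context {R : realType}.
Implicit Types z w : R[i].

Lemma ReD z w : complex.Re (z + w) = complex.Re z + complex.Re w.
Proof. by case: z w => [? ?] [? ?]. Qed.

Lemma ImD z w : complex.Im (z + w) = complex.Im z + complex.Im w.
Proof. by case: z w => [? ?] [? ?]. Qed.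

Lemma ReM z w : complex.Re (z * w)
  = complex.Re z * complex.Re w - complex.Im z * complex.Im w.
Proof. by case: z w => [? ?] [? ?]. Qed.

Lemma ImM z w : complex.Im (z * w)
  = complex.Re z * complex.Im w + complex.Im z * complex.Re w.
Proof. by case: z w => [? ?] [? ?]. Qed.

Lemma divc_natr z n :
  z / n%:R = (complex.Re z / n%:R +i* (complex.Im z / n%:R))%C.
Proof.
have -> : (n%:R : R[i])^-1 = (n%:R^-1)%:C%C by rewrite fmorphV rmorph_nat.
by rewrite [LHS]complexE; apply/eqP; rewrite eq_complex !ReD !ImD !ReM !ImM /=
  !mulr0 !mul0r !subr0 !add0r !addr0 !mul1r !eqxx.
Qed.

(* Real and imaginary parts of cexp (s * z) minus its first n Taylor terms, as
   functions of the real variable s. *)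
Definition cexp_rem_re z n (s : R) :=
  expR (s * complex.Re z) * cos (s * complex.Im z)
  - \sum_(k < n) complex.Re (z ^+ k) * (s ^+ k / k`!%:R).

Definition cexp_rem_im z n (s : R) :=
  expR (s * complex.Re z) * sin (s * complex.Im z)
  - \sum_(k < n) complex.Im (z ^+ k) * (s ^+ k / k`!%:R).

(** Differentiating the Taylor polynomial drops its constant term and shifts the index, which leaves
    the real part of [z] times the previous remainder. *)
Lemma is_derive_cexp_rem_re z n (s : R) : is_derive s 1 (cexp_rem_re z n.+1)
  (complex.Re z * cexp_rem_re z n s - complex.Im z * cexp_rem_im z n s).
Proof.
pose c k := complex.Re (z ^+ k).
have h := is_derive_exp_poly c n s.
have d1 : is_derive s 1
  (fun s => expR (s * complex.Re z) * cos (s * complex.Im z))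
  (complex.Re z * (expR (s * complex.Re z) * cos (s * complex.Im z)) -
   complex.Im z * (expR (s * complex.Re z) * sin (s * complex.Im z))).
  apply: is_derive_eq; rewrite /GRing.scale /=; ring.
apply: (is_derive_eq (is_deriveB d1 h)); rewrite /cexp_rem_re /cexp_rem_im.
set S := \sum_(k < n) _; suff -> : S =
    complex.Re z * (\sum_(k < n) complex.Re (z ^+ k) * (s ^+ k / k`!%:R))
    - complex.Im z * (\sum_(k < n) complex.Im (z ^+ k) * (s ^+ k / k`!%:R)).
  by ring.
rewrite !mulr_sumr -sumrB; apply: eq_bigr => k _.
by rewrite /c exprS ReM; ring.
Qed.

Lemma is_derive_cexp_rem_im z n (s : R) : is_derive s 1 (cexp_rem_im z n.+1)
  (complex.Re z * cexp_rem_im z n s + complex.Im z * cexp_rem_re z n s).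
Proof.
pose c k := complex.Im (z ^+ k).
have h := is_derive_exp_poly c n s.
have d1 : is_derive s 1
  (fun s => expR (s * complex.Re z) * sin (s * complex.Im z))
  (complex.Re z * (expR (s * complex.Re z) * sin (s * complex.Im z)) +
   complex.Im z * (expR (s * complex.Re z) * cos (s * complex.Im z))).
  apply: is_derive_eq; rewrite /GRing.scale /=; ring.
apply: (is_derive_eq (is_deriveB d1 h)); rewrite /cexp_rem_re /cexp_rem_im.
set S := \sum_(k < n) _; suff -> : S =
    complex.Re z * (\sum_(k < n) complex.Im (z ^+ k) * (s ^+ k / k`!%:R))
    + complex.Im z * (\sum_(k < n) complex.Re (z ^+ k) * (s ^+ k / k`!%:R)).
  by ring.
rewrite !mulr_sumr -big_split; apply: eq_bigr => k _.
by rewrite /c exprS ImM /=; ring.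
Qed.

Lemma exp_poly0 (c : nat -> R) n :
  \sum_(k < n.+1) c k * (0 ^+ k / k`!%:R) = c 0%N.
Proof.
rewrite big_ord_recl expr0 divr1 mulr1 big1 ?addr0// => k _.
by rewrite expr0n mul0r mulr0.
Qed.

Lemma cexp_rem_re0 z n : cexp_rem_re z n.+1 0 = 0.
Proof.
rewrite /cexp_rem_re (exp_poly0 (fun k => complex.Re (z ^+ k))) !mul0r.
by rewrite expR0 cos0 mulr1 subrr.
Qed.

Lemma cexp_rem_im0 z n : cexp_rem_im z n.+1 0 = 0.
Proof.
rewrite /cexp_rem_im (exp_poly0 (fun k => complex.Im (z ^+ k))) !mul0r.
by rewrite expR0 sin0 mulr0 subrr.
Qed.

(* The derivative in s of the (n+1)-st remainder is z times the n-th one, so the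
   bound is obtained by integrating n times from 0; splitting into real and
   imaginary parts costs the factor 2 ^ n. *)
Lemma cexp_rem_le z (b : R) n : `|complex.Re z| <= b -> `|complex.Im z| <= b ->
  forall s, 0 <= s <= 1 ->
  `|cexp_rem_re z n s| <= expR b * (2 * b) ^+ n * (s ^+ n / n`!%:R) /\
  `|cexp_rem_im z n s| <= expR b * (2 * b) ^+ n * (s ^+ n / n`!%:R).
Proof.
move=> zR zI; have b0 : 0 <= b by apply: le_trans zR.
elim: n => [|n IHn] s s01.
  rewrite /cexp_rem_re /cexp_rem_im !big_ord0 !subr0 !expr0 divr1 !mulr1.
  rewrite !normrM.
  have eb : `|expR (s * complex.Re z)| <= expR b.
    rewrite ger0_norm ?expR_ge0// ler_expR; move/andP: s01 => [s0 s1].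
    apply: le_trans (ler_norm _) _; rewrite normrM (ger0_norm s0).
    by apply: le_trans zR; rewrite ler_piMl.
  by rewrite -[expR b]mulr1; split; apply: ler_pM => //;
    [exact: cos_max|exact: sin_max].
have lin (x y : R) (t : R) : 0 <= t <= 1 ->
    `|x| <= expR b * (2 * b) ^+ n * (t ^+ n / n`!%:R) ->
    `|y| <= expR b * (2 * b) ^+ n * (t ^+ n / n`!%:R) ->
    `|complex.Re z * x + complex.Im z * y|
      <= expR b * (2 * b) ^+ n.+1 * (t ^+ n / n`!%:R).
  move=> t01 hx hy; apply: le_trans (ler_normD _ _) _; rewrite !normrM.
  apply: le_trans (lerD (ler_pM _ _ zR hx) (ler_pM _ _ zI hy)) _ => //.
  by rewrite exprS le_eqVlt; apply/orP; left; apply/eqP; ring.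
split.
- apply: (@normr_le_monomial _ _ _ _ _ (cexp_rem_re0 z n)
    (is_derive_cexp_rem_re z n)) => //.
  move=> t t01; have [hR hI] := IHn t t01.
  by rewrite -mulrN; apply: lin; rewrite ?normrN.
- apply: (@normr_le_monomial _ _ _ _ _ (cexp_rem_im0 z n)
    (is_derive_cexp_rem_im z n)) => //.
  by move=> t t01; have [hR hI] := IHn t t01; apply: lin.
Qed.

(** The remainder estimate at [s = 1] with [b = |z|]; the leading factor 2 absorbs the passage from
    the two components to the modulus. *)
Lemma cexp_taylor z n : `|cexp z - \sum_(k < n) z ^+ k / k`!%:R|
  <= (2 * expR (cmod z) * exp_coeff (2 * cmod z) n)%:C%C.
Proof.
have [hR hI] := cexp_rem_le n (Re_le_cmod z) (Im_le_cmod z) (s := 1)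
  ltac:(by rewrite ler01 lexx).
set w := _ - _; have -> : w = (cexp_rem_re z n 1 +i* cexp_rem_im z n 1)%C.
  rewrite /w; apply/eqP; rewrite eq_complex; apply/andP; split.
  - rewrite ReD /cexp_rem_re !mul1r [complex.Re (- _)](_ : _ =
      - complex.Re (\sum_(k < n) z ^+ k / k`!%:R));
      last by case: (\sum_(k < n) _).
    rewrite (big_morph _ ReD (erefl : complex.Re 0 = 0)) /=.
    apply/eqP; congr (_ - _); apply: eq_bigr => k _.
    by rewrite divc_natr expr1n mul1r.
  - rewrite ImD /cexp_rem_im !mul1r [complex.Im (- _)](_ : _ =
      - complex.Im (\sum_(k < n) z ^+ k / k`!%:R));
      last by case: (\sum_(k < n) _).
    rewrite (big_morph _ ImD (erefl : complex.Im 0 = 0)) /=.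
    apply/eqP; congr (_ - _); apply: eq_bigr => k _.
    by rewrite divc_natr expr1n mul1r.
rewrite normc_def lecR /=; set B := (X in _ <= X).
have BE : B = 2 * (expR (cmod z) * (2 * cmod z) ^+ n * (1 ^+ n / n`!%:R)).
  by rewrite /B /exp_coeff /= expr1n; ring.
have B0 : 0 <= B by rewrite BE mulr_ge0// (le_trans _ hR).
rewrite -(ger0_norm B0) -sqrtr_sqr ler_sqrt ?sqr_ge0//.
rewrite -(real_normK (num_real (cexp_rem_re z n 1))).
rewrite -(real_normK (num_real (cexp_rem_im z n 1))) BE.
have := normr_ge0 (cexp_rem_re z n 1); have := normr_ge0 (cexp_rem_im z n 1).
by move: hR hI; nra.
Qed.

End ComplexExponentialSeries.

(** * Uniqueness of power series coefficients *)

(** If [a n] were the first nonzero coefficient, then at a small enough [t > 0] its term would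
    outweigh the whole tail, and the sum could not be 0. *)
Lemma power_series_eq0 (K : numFieldType) (a : nat -> K) :
  (forall t, has_series_sum (fun n => a n * t ^+ n) 0) -> forall n, a n = 0.
Proof.
move=> a_t.
(* Convergence at [t = 1] makes the coefficients tend to 0, so they are bounded. *)
have [A A0 aA] : exists2 A : K, 0 < A & forall n, `|a n| <= A.
  have : (fun n => a n * 1 ^+ n) @ \oo --> (0 : K).
    by apply: cvg_series_cvg_0; apply/cvg_ex; exists 0; exact: a_t.
  move=> /cvgrPdist_lt/(_ 1 ltr01)[N0 _ aN0].
  exists (1 + \sum_(k < N0) `|a k|); first by rewrite ltr_pwDl// sumr_ge0.
  move=> n; have [nN0|N0n] := ltnP n N0.
    rewrite (bigD1 (Ordinal nN0))//= addrCA lerDl addr_ge0//.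
    exact: sumr_ge0.
  have := aN0 n N0n; rewrite /= sub0r normrN expr1n mulr1.
  move=> /ltW/le_trans; apply.
  by rewrite lerDl sumr_ge0.
elim/ltn_ind => n IHn; apply/eqP; apply: contraT => an0.
pose c : K := `|a n|; have c0 : 0 < c by rewrite normr_gt0.
(* With this t, the terms of index > n add up to at most half of the n-th. *)
pose D : K := c * 2 + A * 4.
have D0 : 0 < D by rewrite addr_gt0// mulr_gt0.
pose t : K := c / D.
have tD : t * D = c by rewrite divfK// gt_eqF.
have t0 : 0 < t by rewrite divr_gt0.
have t2 : t * 2 <= 1.
  by rewrite mulrAC ler_pdivrMr// mul1r lerDl mulr_ge0// ltW.
have tA : A * 2 * t <= c / 2.
  rewrite ler_pdivlMr// -[leRHS]tD [t * D]mulrDr.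
  have -> : A * 2 * t * 2 = t * (A * 4) by ring.
  by rewrite lerDr; apply: mulr_ge0; [|apply: mulr_ge0 => //]; exact: ltW.
pose S m := series (fun k => a k * t ^+ k) m.
(* As [t <= 1/2], a geometric sum starting at [t ^+ n.+1] is at most twice its first term; the
   factor [1 - t ^+ j] makes the induction close. *)
have SE j : `|S (n.+1 + j)%N - a n * t ^+ n|
    <= A * 2 * t ^+ n.+1 * (1 - t ^+ j).
  elim: j => [|j IHj].
    rewrite addn0 subrr mulr0 /S seriesSr /series /= big_mkord big1.
      by rewrite add0r subrr normr0.
    by move=> k _; rewrite IHn// mul0r.
  rewrite addnS /S seriesSr /= addrAC -/(S _).
  apply: le_trans (ler_normD _ _) _.
  have -> : A * 2 * t ^+ n.+1 * (1 - t ^+ j.+1)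
      = A * 2 * t ^+ n.+1 * (1 - t ^+ j)
        + A * t ^+ (n.+1 + j) * (1 + (1 - t * 2)).
    by rewrite (exprS t j) (exprD t n.+1 j); ring.
  apply: lerD => //; rewrite normrM normrX (gtr0_norm t0).
  apply: (@le_trans _ _ (A * t ^+ (n.+1 + j))).
    by rewrite ler_pM2r ?exprn_gt0.
  by rewrite ler_peMr ?mulr_ge0 ?exprn_ge0 ?(ltW t0) ?(ltW A0)// lerDl subr_ge0.
have e0 : 0 < c / 2 * t ^+ n by rewrite mulr_gt0 ?divr_gt0 ?exprn_gt0.
have /cvgrPdist_lt/(_ _ e0)[N0 _ SN0] := a_t t.
have := SN0 (n.+1 + N0)%N (leq_addl _ _).
rewrite /= sub0r normrN -/(S _) => Slt.
(* The [n]-th term is a partial sum, less than half of [c * t ^+ n] in modulus, minus a tail, at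
   most the other half. *)
have : c * t ^+ n < c * t ^+ n; last by rewrite ltxx.
have {1}-> : c * t ^+ n = `|S (n.+1 + N0)%N - (S (n.+1 + N0)%N - a n * t ^+ n)|.
  by rewrite opprB addrCA subrr addr0 normrM normrX (gtr0_norm t0).
apply: le_lt_trans (ler_normB _ _) _.
have -> : c * t ^+ n = c / 2 * t ^+ n + c / 2 * t ^+ n by field.
apply: ltr_leD => //; apply: le_trans (SE N0) _.
apply: (@le_trans _ _ (A * 2 * t ^+ n.+1)).
  rewrite ler_piMr ?mulr_ge0 ?exprn_ge0 ?(ltW t0) ?(ltW A0)//.
  by rewrite lerBlDr lerDl exprn_ge0// ltW.
by rewrite exprS mulrA ler_pM2r// exprn_gt0.
Qed.

Lemma exp_series_inj (K : numFieldType) (E E' : nat -> K) (g : K -> K) :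
  (forall t, has_series_sum (fun n => E n * (t ^+ n / n`!%:R)) (g t)) ->
  (forall t, has_series_sum (fun n => E' n * (t ^+ n / n`!%:R)) (g t)) ->
  E = E'.
Proof.
move=> hE hE'; apply/funext => n.
have n0 k : (k`!%:R : K) != 0 by rewrite pnatr_eq0 -lt0n fact_gt0.
have /power_series_eq0/(_ n)/eqP :
    forall t, has_series_sum (fun n => (E n - E' n) / n`!%:R * t ^+ n) 0.
  move=> t; rewrite /has_series_sum -(subrr (g t)).
  have -> : series (fun n => (E n - E' n) / n`!%:R * t ^+ n)
      = series (fun n => E n * (t ^+ n / n`!%:R))
        - series (fun n => E' n * (t ^+ n / n`!%:R)).
    apply/funext => m; rewrite /series fctE /= -sumrB.
    by apply: eq_bigr => k _; have := n0 k => ?; field.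
  by apply: cvgB; [exact: hE|exact: hE'].
by rewrite mulf_eq0 invr_eq0 (negbTE (n0 n)) orbF subr_eq0 => /eqP.
Qed.

(** * Geometric sums over multi-indices and bounded characters *)

Lemma geometric_sum_le (K : numFieldType) (x : K) n : 0 <= x < 1 ->
  \sum_(k < n) x ^+ k <= (1 - x)^-1.
Proof.
move=> /andP[x0 x1]; rewrite -[leRHS]mul1r ler_pdivlMr ?subr_gt0// mulrC.
by rewrite -opprB mulNr -subrX1 opprB lerBlDr lerDl exprn_ge0.
Qed.

(** A finite set of multi-indices lies in a cube, over which the sum factors into [r] one-variable
    geometric sums. *)
Lemma partial_sum_expr_mtot (K : numFieldType) r (x : K)
    (A : {fset {ffun 'I_r -> nat}}) : 0 <= x < 1 ->
  partial_sum (fun m => x ^+ mtot m) A <= (1 - x)^-1 ^+ r.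
Proof.
move=> x01; have /andP[x0 x1] := x01.
(* [N] is the largest coordinate occurring in [A], so the cube [B] of side [N.+1] contains [A]. *)
pose N := \max_(m <- A) \max_i m i.
pose h (g : {ffun 'I_r -> 'I_N.+1}) : {ffun 'I_r -> nat} :=
  [ffun i => val (g i)].
pose B := [fset h g | g : {ffun 'I_r -> 'I_N.+1}]%fset.
have AB : (A `<=` B)%fset.
  apply/fsubsetP => m mA; apply/imfsetP; exists [ffun i => inord (m i)] => //.
  apply/ffunP => i; rewrite !ffunE /= inordK// ltnS.
  apply: (@leq_trans (\max_i m i)); first exact: leq_bigmax.
  exact: (leq_bigmax_seq (F := fun m : {ffun 'I_r -> nat} => \max_i m i)).
apply: le_trans (partial_sum_subset _ AB) _.
  by move=> m; rewrite exprn_ge0.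
rewrite partial_sumE big_imfset /=; last first.
  move=> g g' _ _ /ffunP gg'; apply/ffunP => i; apply: val_inj.
  by have := gg' i; rewrite !ffunE.
rewrite big_enum /=.
have -> : \sum_(g : {ffun 'I_r -> 'I_N.+1}) x ^+ mtot (h g)
    = \prod_(i < r) \sum_(j < N.+1) x ^+ j.
  rewrite bigA_distr_bigA /=; apply: eq_bigr => g _.
  by rewrite /mtot expr_sum; apply: eq_bigr => i _; rewrite ffunE.
rewrite prodr_const card_ord.
by apply: lerXn2r; rewrite ?nnegrE ?invr_ge0 ?subr_ge0 ?(ltW x1)//;
  [apply: sumr_ge0 => j _; rewrite exprn_ge0|exact: geometric_sum_le].
Qed.

(** By periodicity every value occurs among the residues modulo [N], so the sum of the moduli over
    one period is a bound. *)
Lemma dirichlet_character_bounded (R : realType) N (chi : int -> R[i]) :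
  dirichlet_character N chi -> exists B : R[i], forall a, `|chi a| <= B.
Proof.
case=> N0 _ chi_mod _; exists (\sum_(k < N) `|chi k%:Z|) => a.
have Nz : N%:Z != 0 by rewrite -lt0n in N0 *; case: (N) N0.
have -> : chi a = chi `|(a %% N%:Z)%Z|%N%:Z.
  by apply: chi_mod; rewrite gez0_abs ?modz_ge0// modz_mod.
have lt : (`|(a %% N%:Z)%Z| < N)%N.
  by rewrite -ltz_nat gez0_abs ?modz_ge0// ltz_pmod.
by rewrite (bigD1 (Ordinal lt))//= lerDl sumr_ge0.
Qed.

(** * Exchange of the multiple sum with the exponential series *)

Lemma has_usum_msum (K : numFieldType) r (u : {ffun 'I_r -> nat} -> K) (l : K) :
  has_usum u l -> msummable u /\ Defs.msum u = l.
Proof.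
move=> ul; split; first by apply/cvg_ex; exists l.
exact: (cvg_lim (@norm_hausdorff _ K)).

Qed.

Lemma has_series_sumMl (K : numFieldType) (c : K) (u : nat -> K) (l : K) :
  has_series_sum u l -> has_series_sum (fun n => c * u n) (c * l).
Proof.
move=> ul; rewrite /has_series_sum.
have -> : series (fun n => c * u n) = (fun n => c * series u n).
  by apply/funext => n; rewrite /series /= mulr_sumr.
exact: cvgMl_tmp.
Qed.

(** Uniformity on a disc allows one remainder bound to serve all indices of a sum at once. *)
Lemma cexp_taylor_unif (R : realType) (z : R[i]) (b : R) n :
  `|z| <= b%:C%C ->
  `|cexp z - \sum_(k < n) z ^+ k / k`!%:R|
    <= (2 * expR b * exp_coeff (2 * b) n)%:C%C.
Proof.
rewrite norm_cmod lecR => zb; apply: le_trans (cexp_taylor z n) _; rewrite lecR.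
have z0 : 0 <= cmod z by rewrite -ler0c -norm_cmod.
have b0 := le_trans z0 zb.
rewrite /exp_coeff /=; apply: ler_pM.
- by rewrite mulr_ge0// expR_ge0.
- by rewrite divr_ge0// exprn_ge0// mulr_ge0.
- by rewrite ler_pM2l// ler_expR.
- rewrite ler_pM2r ?invr_gt0 ?ltr0n ?fact_gt0//.
  by apply: lerXn2r; rewrite ?nnegrE ?mulr_ge0// ler_pM2l.
Qed.

(** Only finitely many Taylor terms are exchanged with the sum, which is linearity. What remains is
    at most the uniform remainder [d n] times the total weight [W], and this tends to 0. *)
Lemma usum_cexp_exchange (R : realType) (I : choiceType) (w s : I -> R[i])
    (W S : R[i]) :
  (forall A, partial_sum (fun i => `|w i|) A <= W) ->
  (forall i, `|s i| <= S) -> 0 <= S ->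
  exists e : nat -> R[i],
    (forall n, has_usum (fun i => w i * s i ^+ n) (e n)) /\
    forall t, exists g, has_usum (fun i => w i * cexp (s i * t)) g /\
      has_series_sum (fun n => e n * (t ^+ n / n`!%:R)) g.
Proof.
move=> wW sS S0.
(* Multiplying the weights by a bounded family keeps them absolutely summable. *)
have WS (v : I -> R[i]) (B : R[i]) : 0 <= B -> (forall i, `|v i| <= B) ->
    forall A, partial_sum (fun i => `|w i * v i|) A <= B * W.
  move=> B0 vB A; apply: (@le_trans _ _ (partial_sum (fun i => B * `|w i|) A)).
    by apply: ler_partial_sum => i; rewrite normrM mulrC ler_wpM2r.
  by rewrite partial_sumMl ler_wpM2l.
have /choice[e he] : forall n, exists l, has_usum (fun i => w i * s i ^+ n) l.
  move=> n; apply: (@has_usum_abs _ _ _ (S ^+ n * W)); apply: WS.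
    by rewrite exprn_ge0.
  by move=> i; rewrite normrX lerXn2r// nnegrE.
exists e; split=> // t.
pose b := cmod (S * t).
have b0 : 0 <= b by rewrite -ler0c /b -norm_cmod.
have stb i : `|s i * t| <= b%:C%C.
  by rewrite -norm_cmod !normrM ler_wpM2r// (ger0_norm S0).
have [g hg] : exists g, has_usum (fun i => w i * cexp (s i * t)) g.
  apply: (@has_usum_abs _ _ _ ((expR b)%:C%C * W)); apply: WS.
    by rewrite ler0c expR_ge0.
  move=> i; rewrite norm_cexp lecR ler_expR (le_trans (ler_norm _))//.
  by rewrite (le_trans (Re_le_cmod _))// -lecR -norm_cmod.
exists g; split=> //.
pose d n := 2 * expR b * exp_coeff (2 * b) n.
have gd n :
    `|g - series (fun n => e n * (t ^+ n / n`!%:R)) n| <= (d n)%:C%C * W.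
  rewrite /series /= big_mkord.
  have h1 : has_usum
      (fun i => \sum_(k < n) (t ^+ k / k`!%:R) * (w i * s i ^+ k))
      (\sum_(k < n) (t ^+ k / k`!%:R) * e k).
    exact: (has_usum_sum (fun k => has_usumMl (c := t ^+ k / k`!%:R) (he k))).
  have h2 := has_usumD hg (has_usumMl (c := -1) h1).
  have -> : g - \sum_(k < n) e k * (t ^+ k / k`!%:R)
      = g + -1 * (\sum_(k < n) (t ^+ k / k`!%:R) * e k).
    by rewrite mulN1r; under eq_bigr do rewrite mulrC.
  apply: (has_usum_norm_le h2) => A.
  have -> : (fun i => `|w i * cexp (s i * t)
        + -1 * (\sum_(k < n) (t ^+ k / k`!%:R) * (w i * s i ^+ k))|)
      = (fun i =>
          `|w i * (cexp (s i * t) - \sum_(k < n) (s i * t) ^+ k / k`!%:R)|).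
    apply/funext => i; rewrite mulN1r mulrBr mulr_sumr; congr `|_ - _|.
    by apply: eq_bigr => k _; rewrite exprMn; ring.
  apply: WS; last by move=> i; exact: cexp_taylor_unif.
  rewrite ler0c; apply: mulr_ge0; first by rewrite mulr_ge0// expR_ge0.
  by apply: exp_coeff_ge0; rewrite mulr_ge0.
(* [W] is nonnegative, hence real, so the final limit can be taken in [R], where the terms of the
   exponential series tend to 0. *)
have W0 : 0 <= W.
  by apply: le_trans (wW fset0); apply: sumr_ge0.
have WE : W = (complex.Re W)%:C%C by rewrite RRe_real// ger0_real.
have d0 : (fun n => complex.Re W * d n) @ \oo --> (0 : R).
  rewrite -(mulr0 (complex.Re W)); apply: cvgMl_tmp.
  rewrite -(mulr0 (2 * expR b)); apply: cvgMl_tmp.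
  exact: cvg_exp_coeff.
apply/cvgrPdist_lt => eps eps0.
have epsE : eps = (complex.Re eps)%:C%C by rewrite RRe_real// gtr0_real.
have eps0' : 0 < complex.Re eps by move: eps0; rewrite {1}epsE ltcR.
move/cvgrPdist_lt/(_ _ eps0') : d0; apply: filterS => n.
rewrite sub0r normrN => dn; apply: le_lt_trans (gd n) _.
rewrite WE -rmorphM /= epsE ltcR mulrC; apply: le_lt_trans dn.
exact: ler_norm.
Qed.

(** * Bounds and nonvanishing for the terms of the q-series *)

Section QEulerSeries.
Context {R : realType}.
Variables (q L : R[i]) (x : R) (chi : int -> R[i]).
Hypotheses (qL : cexp L = q) (q1 : `|q| < 1).

Lemma log_re_lt0 : complex.Re L < 0.
Proof.
by move: q1; rewrite -qL norm_cexp -[1]/(1%:C%C) ltcR -expR0 ltr_expR.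
Qed.

Lemma subr1q_neq0 : 1 - q != 0.
Proof.
rewrite subr_eq0; apply/eqP => q1E.
by move: q1; rewrite -q1E normr1 ltxx.
Qed.

Lemma norm_qpow_real (y : R) :
  `|qpow L y%:C%C| = (expR (y * complex.Re L))%:C%C.
Proof. by rewrite norm_cexp ReM /= mul0r subr0. Qed.

Lemma qshiftE r (m : {ffun 'I_r -> nat}) :
  qshift q L x m = (1 - qpow L ((mtot m)%:R + x)%:C%C) / (1 - q).
Proof. by rewrite /qshift /qnum rmorphD rmorph_nat. Qed.

(** Since [Re L < 0], the modulus [exp ((|m| + x) Re L)] of the q-power is largest at [|m| = 0],
    which gives a bound independent of [m]. *)
Lemma norm_qshift_le r (m : {ffun 'I_r -> nat}) :
  `|qshift q L x m| <= (1 + (expR (x * complex.Re L))%:C%C) / `|1 - q|.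
Proof.
rewrite qshiftE normf_div ler_pM2r ?invr_gt0 ?normr_gt0 ?subr1q_neq0//.
rewrite (le_trans (ler_normB _ _))// normr1 lerD2l norm_qpow_real lecR ler_expR.
by rewrite ler_wnM2r ?(ltW log_re_lt0)// lerDr.
Qed.

(** A zero would give a q-power of modulus 1, so [(|m| + x) Re L = 0] and [x = - |m|], which is
    excluded. *)
Lemma qshift_neq0 r (m : {ffun 'I_r -> nat}) :
  (forall k : nat, x != - k%:R) -> qshift q L x m != 0.
Proof.
move=> hx; rewrite qshiftE mulf_neq0 ?invr_eq0 ?subr1q_neq0// subr_eq0.
apply/eqP => /(congr1 Num.norm); rewrite normr1 norm_qpow_real.
move=> -[] /esym /eqP.
rewrite -[X in _ == X -> _]expR0 (inj_eq (@expR_inj R)).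
rewrite mulf_eq0 (lt_eqF log_re_lt0) orbF addr_eq0 => /eqP mx.
by have := hx (mtot m); rewrite mx opprK eqxx.
Qed.

Lemma norm_qweight_le r (B : R[i]) (m : {ffun 'I_r -> nat}) :
  (forall a, `|chi a| <= B) -> `|qweight q chi m| <= B ^+ r * `|q| ^+ mtot m.
Proof.
move=> chiB; rewrite normrM normrX normrN mulrC ler_wpM2r ?exprn_ge0//.
rewrite normr_prod -[r in B ^+ r]card_ord -prodr_const.
by apply: ler_prod => i _; rewrite normr_ge0 chiB.
Qed.

Lemma partial_sum_qweight_le r (B : R[i]) (A : {fset {ffun 'I_r -> nat}}) :
  (forall a, `|chi a| <= B) ->
  partial_sum (fun m => `|qweight q chi m|) A <= B ^+ r * (1 - `|q|)^-1 ^+ r.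
Proof.
move=> chiB; have B0 : 0 <= B by apply: le_trans (chiB 0).
apply: (@le_trans _ _ (partial_sum (fun m => B ^+ r * `|q| ^+ mtot m) A)).
  by apply: ler_partial_sum => m; exact: norm_qweight_le.
rewrite partial_sumMl ler_wpM2l ?exprn_ge0//.
by apply: partial_sum_expr_mtot; rewrite normr_ge0.
Qed.

Lemma ql_term_opp_nat r (n : nat) : (forall k : nat, x != - k%:R) ->
  ql_term q L (r := r) chi x (- n%:R)
    = (fun m => qweight q chi m * qshift q L x m ^+ n).
Proof.
move=> hx; apply/funext => m.
by rewrite /ql_term cpow_opp_nat ?invrK// qshift_neq0.
Qed.

Lemma is_qEuler_inj r (E E' : nat -> R[i]) :
  is_qEuler q L r chi x E -> is_qEuler q L r chi x E' -> E = E'.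
Proof.
move=> hE hE'; apply: (@exp_series_inj _ E E' (qgen q L r chi x)) => t.
- by have [] := hE t.
- by have [] := hE' t.
Qed.

End QEulerSeries.

(* The first two conjuncts say that the two sides are well defined: the
   generating function identity defining E holds, and the multiple series
   defining l_q(-n, x | chi) converges. *)
Theorem theorem5 (R : realType) (q L : R[i]) (hL : cexp L = q)
    (hq : `|q| < 1) (r : nat) (hr : (0 < r)%N) (n : nat)
    (x : R) (hx : forall k : nat, x != - k%:R)
    (f : nat) (hf : odd f) (chi : int -> R[i])
    (hchi : dirichlet_character_of_conductor f chi) :
  [/\ is_qEuler q L r chi x (qEuler q L r chi x),
      msummable (@ql_term R q L r chi x (- n%:R))
    & ql q L r chi x (- n%:R) = qEuler q L r chi x n].
Proof.
have [N [/dirichlet_character_bounded[B chiB] _ _]] := hchi.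
have [|e [he hg]] := usum_cexp_exchange
  (fun A => partial_sum_qweight_le (r := r) hq A chiB)
  (norm_qshift_le x hL hq (r := r)).
  by rewrite divr_ge0// addr_ge0// ler0c expR_ge0.
(* Explicit candidate: the multiple sum of the weights times the [k]-th powers of the shifts, with
   the normalising factor. *)
pose E k := qnum q L 2 ^+ r * e k.
have EP : is_qEuler q L r chi x E.
  move=> t; have [g [gu gs]] := hg t.
  have gu' : has_usum (qgen_term q L chi x t) g := gu.
  have [gsum gE] := has_usum_msum gu'; split; first exact: gsum.
  rewrite /qgen gE /E.
  under eq_fun do rewrite -mulrA.
  exact: has_series_sumMl.
(* The witness [E] rules out the default value of [xget]. *)
have qP : is_qEuler q L r chi x (qEuler q L r chi x).
  exact: (@xgetPex _ _ [set E | is_qEuler q L r chi x E] (ex_intro _ E EP)).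
have hl : has_usum (ql_term q L (r := r) chi x (- n%:R)) (e n).
  rewrite ql_term_opp_nat; [exact: he|exact: hL|exact: hq|exact: hx].
have [lsum lE] := has_usum_msum hl.
(* Uniqueness identifies the chosen sequence with the explicit one. *)
rewrite (is_qEuler_inj qP EP); split; [exact: EP|exact: lsum|].
by rewrite /ql lE.
Qed.
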